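(* Let $d=1$. For any given $\Delta>0$, $L>0$, $p\in(1,2]$, $\sigma\ge0$, $0<\epsilon\le\sqrt{2\Delta L}$, $x_1\in\mathbb{R}$, $\gamma>0$, and $\lambda\ge0$ satisfying $\lambda=0$ when $\sigma=0$, there exist a function $f:\mathbb{R}\to\mathbb{R}$, a function $g:\mathbb{R}\times\{0,1\}\to\mathbb{R}$ and a Bernoulli distribution $\mathbb{P}$ on $\{0,1\}$ satisfying 1. $f(x_1)-\inf_{x\in\mathbb{R}}f(x)\le\Delta$ and $f$ is $L$-smooth; 2. for every $x\in\mathbb{R}$, $\mathbb{E}_{r\sim\mathbb{P}}[g(x;r)]=f'(x)$ and $\mathbb{E}_{r\sim\mathbb{P}}[|g(x;r)-f'(x)|^p]\le\sigma^p$. Moreover, for this $f$, $g$, $\mathbb{P}$: suppose AdaGrad with initial point $x_1$, learning rate $\gamma$ and hyperparameter $\lambda$ is used to optimize $f$ by interacting with $g$ (i.e. $g_t=g(x_t;r_t)$ where $r_t\sim\mathbb{P}$ is independent of the history), and suppose $\epsilon$ is small enough that $$\epsilon\le\sqrt{\Delta L},\qquad \ln\left(1+\frac{1}{\left(\frac{\lambda q}{\epsilon}\right)^2+1}\right)\ge\frac{16\epsilon}{\gamma L},\qquad \frac{16\epsilon}{\gamma L}\sqrt{\left(\frac{\lambda q}{\epsilon}\right)^2+1}\le\frac{\ln c}{\sqrt{2c}},$$ where $q:=\left[1+\frac{p-1}{4}\left(\frac{2\sigma}{\epsilon}\right)^p\right]^{-\frac1{p-1}}$ and $c\in[3.92,3.93]$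 is the unique positive solution of $2c=(1+c)\ln(1+c)$. Then, to have $\mathbb{E}\left[\frac1T\sum_{t=1}^T|f'(x_t)|\right]<\frac\epsilon2$, the number of iterations $T\in\mathbb{N}$ must be at least $$\Omega\left(\frac{\frac{\lambda\Delta}{\gamma}+\frac{\Delta^2}{\gamma^2}+\gamma^2L^2\ln^2 M}{\epsilon^2}+\frac{\left(\frac{\Delta^2}{\gamma^2}+\gamma^2L^2\ln^2 M\right)\sigma^{\frac p{p-1}}}{\epsilon^{\frac{3p-2}{p-1}}}\right),\qquad M:=\frac{\gamma L\left(1+\sigma^{\frac p{p-1}}\epsilon^{-\frac p{p-1}}\right)}{\lambda+\epsilon\left(1+\sigma^{\frac p{p-1}}\epsilon^{-\frac p{p-1}}\right)}.$$
   Context: One-dimensional AdaGrad with initial point $x_1$, learning rate $\gamma>0$ and hyperparameter $\lambda\ge0$: $v_0=0$ and, for $t=1,2,\dots$, receive the stochastic gradient $g_t$ at $x_t$, set $v_t=v_{t-1}+g_t^2$ and $x_{t+1}=x_t-\frac{\gamma}{\lambda+\sqrt{v_t}}g_t$, where the step is read as $0$ when $g_t=0$ (so $0/0=0$ when $\lambda=0$ and $v_t=0$). A differentiable $f:\mathbb{R}\to\mathbb{R}$ is $L$-smooth if $|f'(x)-f'(y)|\le L|x-y|$ for all $x,y$. $\ln^2(\cdot)$ means $(\ln(\cdot))^2$. $\Omega(\cdot)$ hides a positive constant that depends at most on $p$. *)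

(* Defs.v *)
From HB Require Import structures.
From mathcomp Require Import all_boot all_order all_algebra.
From mathcomp Require Import all_classical all_reals all_analysis.

Set Implicit Arguments.
Unset Strict Implicit.
Unset Printing Implicit Defensive.

Import Order.TTheory GRing.Theory Num.Theory.
Import numFieldNormedType.Exports.

Local Open Scope classical_set_scope.
Local Open Scope ring_scope.

Definition smooth {R : realType} (L : R) (f : R -> R) : Prop :=
  (forall x, derivable f x 1) /\
  (forall x y, `|derive1 f x - derive1 f y| <= L * `|x - y|).

(* The infimum is taken in the extended reals, so the inequality fails when
   f is unbounded below. *)
Definition gap_le {R : realType} (Delta : R) (f : R -> R) (x1 : R) : Prop :=
  ((f x1)%:E - ereal_inf (range (EFin \o f)) <= Delta%:E)%E.

Definition oracle_for {R : realType} (p sigma : R) (f : R -> R)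
    (g : R -> bool -> R) (P : probability bool R) : Prop :=
  forall x : R,
    'E_P[g x]%E = (derive1 f x)%:E /\
    ('E_P[(fun b => `|g x b - derive1 f x| `^ p)%R] <= (sigma `^ p)%:E)%E.

(* [adagrad _ _ _ _ r n] is the pair (x_{n+1}, v_n) of the
   1-based iterates; [r n] is the random seed r_{n+1}.  Division by zero
   is 0 in MathComp, and a zero gradient gives a zero step. *)
Fixpoint adagrad {R : realType} (gamma lambda : R) (g : R -> bool -> R)
    (x1 : R) (r : nat -> bool) (n : nat) : R * R :=
  if n is m.+1 then
    let: (x, v) := adagrad gamma lambda g x1 r m in
    let gt := g x (r m) in
    let v' := v + gt ^+ 2 in
    (x - gamma / (lambda + Num.sqrt v') * gt, v')
  else (x1, 0).

Definition adagrad_x {R : realType} (gamma lambda : R) (g : R -> bool -> R)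
    (x1 : R) (r : nat -> bool) (n : nat) : R :=
  (adagrad gamma lambda g x1 r n).1.

Definition history d (Om : measurableType d) (R : realType)
    (P : probability Om R) (r : nat -> {RV P >-> bool}) (n : nat) (w : Om) :
    n.-tuple bool :=
  [tuple r i w | i < n].

(* Every subset of [bool] or of [n.-tuple bool] is an event.  The initial
   point is deterministic, so the history of AdaGrad before the (n+1)-th query
   is a function of the first n seeds. *)
Definition fresh_samples d (Om : measurableType d) (R : realType)
    (P : probability Om R) (D : probability bool R)
    (r : nat -> {RV P >-> bool}) : Prop :=
  forall n : nat,
    (forall B : set bool, distribution P (r n) B = D B) /\
    (forall (B : set bool) (H : set (n.-tuple bool)),
      P ((r n @^-1` B) `&` (history r n @^-1` H)) =
      (P (r n @^-1` B) * P (history r n @^-1` H))%E).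

Definition avg_grad {R : realType} (gamma lambda : R) (f : R -> R)
    (g : R -> bool -> R) (x1 : R) (T : nat) (r : nat -> bool) : R :=
  T%:R^-1 * \sum_(t < T) `|derive1 f (adagrad_x gamma lambda g x1 r t)|.

Definition c_equation {R : realType} (c : R) : Prop :=
  0 < c /\ 2 * c = (1 + c) * ln (1 + c).

Definition q_of {R : realType} (p sigma eps : R) : R :=
  (1 + (p - 1) / 4 * (2 * sigma / eps) `^ p) `^ (- (1 / (p - 1))).

Definition eps_small {R : realType}
    (c p Delta L sigma eps gamma lambda : R) : Prop :=
  let A := (lambda * q_of p sigma eps / eps) ^+ 2 + 1 in
  [/\ eps <= Num.sqrt (Delta * L),
      ln (1 + 1 / A) >= 16 * eps / (gamma * L) &
      16 * eps / (gamma * L) * Num.sqrt A <= ln c / Num.sqrt (2 * c)].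

Definition M_of {R : realType} (p L sigma eps gamma lambda : R) : R :=
  let s := sigma `^ (p / (p - 1)) * eps `^ (- (p / (p - 1))) in
  (gamma * L * (1 + s)) / (lambda + eps * (1 + s)).

Definition complexity {R : realType}
    (p Delta L sigma eps gamma lambda : R) : R :=
  let lnM2 := (ln (M_of p L sigma eps gamma lambda)) ^+ 2 in
  (lambda * Delta / gamma + Delta ^+ 2 / gamma ^+ 2
     + gamma ^+ 2 * L ^+ 2 * lnM2) / eps ^+ 2
  + (Delta ^+ 2 / gamma ^+ 2 + gamma ^+ 2 * L ^+ 2 * lnM2)
      * sigma `^ (p / (p - 1)) / eps `^ ((3 * p - 2) / (p - 1)).

(* Main.v *)
Require Import Defs.
From HB Require Import structures.
From mathcomp Require Import all_boot all_order all_algebra.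
From mathcomp Require Import all_classical all_reals all_analysis.
From mathcomp Require Import measurable_realfun ring lra.

Set Implicit Arguments.
Unset Strict Implicit.
Unset Printing Implicit Defensive.

Import Order.TTheory GRing.Theory Num.Theory.
Import numFieldNormedType.Exports.

Local Open Scope classical_set_scope.
Local Open Scope ring_scope.

(** Seen from the number of nonzero samples received so far, AdaGrad is
    deterministic on this instance.  The oracle returns [f' x / q] with
    probability [q] and [0] otherwise, so as long as every visited point has
    derivative [- eps], the [n]-th nonzero sample moves the iterate to the
    right by [gamma / (a + sqrt n)] with [a = lambda * q / eps], and the
    iterates run through a fixed increasing sequence [y_0 = x1, y_1, ...].
    The function is built around that sequence: its derivative is
    [- eps + L * dist(x, S)], where [S] consists of the half-line below [y_0]
    and of the points [y_0, ..., y_N].  It is [L]-smooth because a distance is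
    1-Lipschitz, it has slope [- eps] at every [y_k], and it is nevertheless
    not a descent: over a step of length [eta] it changes by
    [L eta^2 / 4 - eps eta].

    Early steps, longer than [4 eps / L], therefore climb, by a total of
    about [gamma^2 L sum_k 1 / (a + sqrt k)^2], which is of order
    [gamma^2 L ln (gamma L / (lambda q + eps))]; this is the source of the
    logarithm ([climb_le]).  The late steps come down with slope at most [eps].
    Since [f] may lose a further [Delta / 2] below its start, the descent is
    affordable until [eps gamma sum_k 1 / (a + sqrt k)] exceeds the climb plus
    [Delta / 2], and bounding the sum by [2 sqrt n] and by [n / a] gives the
    two terms of [horizon] ([energy_ge]).

    Up to [horizon] nonzero samples the gradient at the iterate has norm [eps],
    so an average below [eps / 2] forces the expected number [q * T] of nonzero
    samples to be at least half of [horizon], by the argument of Markov's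
    inequality ([markov_hits]).  It remains to check that [q] is
    large enough for the [p]-th moment of the noise ([sparse_noise]) and that
    [1 / q] is, up to a factor depending on [p], the quantity
    [1 + sigma^(p/(p-1)) eps^(-p/(p-1))] of the claim ([q_of_equiv]). *)

(** * The constant [c] *)

Section constant.
Context {R : realType}.
Implicit Types x y c : R.

Lemma expR_ge_partial x n : 0 <= x -> series (exp_coeff x) n <= expR x.
Proof.
move=> x0; apply: nondecreasing_cvgn_le; last exact: is_cvg_series_exp_coeff.
by apply: nondecreasing_series => k _ _; exact: exp_coeff_ge0.
Qed.

Let upper (x : R) : R :=
  1 + x + x ^+ 2 / 2 + x ^+ 3 / 6 + x ^+ 4 / 24 + x ^+ 5 / 60.

(** The last Taylor coefficient is doubled: the product of this polynomial with
    [expR (- x)] then has derivative [x ^ 4 (1 / 24 - x / 60) expR (- x)],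
    which is nonnegative on the unit interval. *)
Lemma expR_le_poly5 x : 0 <= x -> x <= 1 ->
  expR x <= 1 + x + x ^+ 2 / 2 + x ^+ 3 / 6 + x ^+ 4 / 24 + x ^+ 5 / 60.
Proof.
rewrite le_eqVlt => /predU1P[<- _|x0 x1].
  by rewrite expR0 !expr0n/= !mul0r !addr0.
pose F (t : R) := upper t * expR (- t).
pose dF (t : R) := t ^+ 4 * (1 / 24 - t / 60) * expR (- t).
have dFP (t : R) : is_derive t (1 : R) F (dF t).
  rewrite /F /upper /dF; apply: is_derive_eq.
  by rewrite /GRing.scale/=; field.
have cF : {within `[0, x], continuous F}.
  apply: derivable_within_continuous => u _; by case: (dFP u).
have [s] := MVT x0 (fun u _ => dFP u) cF.
rewrite in_itv/= => /andP[s0 sx] Fx.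
have : 0 <= F x - F 0.
  rewrite Fx subr0 !mulr_ge0 ?expR_ge0 ?exprn_ge0//; lra.
rewrite /F {2}/upper oppr0 expR0 !expr0n/= !mul0r !addr0 mulr1 subr_ge0 expRN.
by rewrite ler_pdivlMr ?expR_gt0// mul1r.
Qed.

(* [c_equation c] says that [h] vanishes at the positive point [c]; its
   derivative [ln (1 + x) - 1] vanishes only once on the half-line. *)
Let h (x : R) : R := (1 + x) * ln (1 + x) - 2 * x.

Let dh x : 0 <= x -> is_derive (x : R) (1 : R) h (ln (1 + x) - 1).
Proof.
move=> x0; have x10 : 0 < 1 + x by lra.
rewrite /h; apply: is_derive_eq.
  have l : is_derive (x : R) (1 : R) (fun t : R => ln (1 + t)) (1 + x)^-1.
    have d1 := is_deriveD (is_derive_cst (1 : R) x (1 : R))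
      (is_derive_id x (1 : R)).
    have := is_derive1_comp (is_derive1_ln x10) d1.
    by rewrite add0r mulr1.
  apply: is_deriveB.
rewrite /GRing.scale/=; field; lra.
Qed.

Let h_MVT x y : 0 <= x -> x < y -> h x = h y ->
  exists2 t, x < t < y & ln (1 + t) = 1.
Proof.
move=> x0 xy hxy.
have D t : t \in `[x, y] -> is_derive (t : R) (1 : R) h (ln (1 + t) - 1).
  by rewrite in_itv/= => /andP[xt _]; apply: dh; exact: le_trans xt.
have cont : {within `[x, y], continuous h}.
  by apply: derivable_within_continuous => u /D [].
have Doo (u : R) : u \in `]x, y[ -> is_derive u (1 : R) h (ln (1 + u) - 1).
  by move=> uI; apply: D; exact: subset_itv_oo_cc.
have [t tI] := MVT xy Doo cont.
rewrite hxy subrr => /esym/eqP; rewrite mulf_eq0 !subr_eq0.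
rewrite [y == x]gt_eqF// orbF => /eqP lt.
by exists t.
Qed.


Lemma expR_ge_poly5 x : 0 <= x ->
  1 + x + x ^+ 2 / 2 + x ^+ 3 / 6 + x ^+ 4 / 24 + x ^+ 5 / 120 <= expR x.
Proof.
move=> x0; apply: le_trans (expR_ge_partial 6 x0).
rewrite /series/= !big_nat_recr//= big_nil /exp_coeff/=.
have [f0 f1 f2] : [/\ 0`! = 1, 1`! = 1 & 2`! = 2]%N by [].
have [f3 f4 f5] : [/\ 3`! = 6, 4`! = 24 & 5`! = 120]%N by [].
rewrite f0 f1 f2 f3 f4 f5; lra.
Qed.

(* 49 / 123 is a quarter of 2 * 3.92 / 4.92 *)
Let h_lower : (492 / 100) * ln (492 / 100) <= 2 * (392 / 100) :> R.
Proof.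
have : ln (492 / 100) <= 4 * (49 / 123) :> R.
  rewrite -ler_expR lnK ?posrE; last lra.
  rewrite expRM_natl; set e := expR _.
  have := @expR_ge_poly5 (49 / 123) ltac:(lra); rewrite -/e => l1.
  have l2 : 70 / 47 <= e by apply: le_trans l1; lra.
  have l3 : (70 / 47) ^+ 4 <= e ^+ 4.
    by apply: lerXn2r => //; rewrite nnegrE ?expR_ge0//; lra.
  by apply: le_trans l3; lra.
lra.
Qed.

(* 393 / 986 is a quarter of 2 * 3.93 / 4.93 *)
Let h_upper : 2 * (393 / 100) <= (493 / 100) * ln (493 / 100) :> R.
Proof.
have : 4 * (393 / 986) <= ln (493 / 100) :> R.
  rewrite -ler_expR lnK ?posrE; last lra.
  rewrite expRM_natl; set e := expR _.
  have := @expR_le_poly5 (393 / 986) ltac:(lra) ltac:(lra).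
  rewrite -/e => l1.
  have l2 : e <= 149 / 100 by apply: le_trans l1 _; lra.
  have l3 : e ^+ 4 <= (149 / 100) ^+ 4.
    by apply: lerXn2r => //; rewrite nnegrE ?expR_ge0//; lra.
  by apply: le_trans l3 _; lra.
lra.
Qed.

Lemma c_equation_unique :
  exists c : R, [/\ unique c_equation c, 392 / 100 <= c & c <= 393 / 100].
Proof.
have h392 : h (392 / 100) <= 0.
  rewrite /h (_ : 1 + _ = 492 / 100); last lra.
  have := h_lower; lra.
have h393 : 0 <= h (393 / 100).
  rewrite /h (_ : 1 + _ = 493 / 100); last lra.
  have := h_upper; lra.
have [|||c] := @IVT R h (392 / 100) (393 / 100) 0.
- lra.
- apply: derivable_within_continuous => t; rewrite in_itv/= => /andP[t0 _].
  by case: (@dh t ltac:(lra)).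
- by rewrite ge_min le_max h392 h393 orbT.
rewrite in_itv/= => /andP[c1 c2] hc.
exists c; split => //; split.
  split; first lra.
  by apply/eqP; rewrite eq_sym -subr_eq0 -/(h c) hc.
have h0 : h 0 = 0 by rewrite /h addr0 ln1 !mulr0 subrr.
(* two distinct positive zeros of [h], together with its zero at the origin,
   would give two distinct solutions of ln (1 + t) = 1 *)
have aux a b : 0 < a -> a < b -> h a = 0 -> h b = 0 -> False.
  move=> a0 ab ha hb.
  have [|t /andP[t0 ta] lt] := @h_MVT 0 a (lexx _) a0; first by rewrite h0 ha.
  have [|s /andP[as_ sb] ls] := @h_MVT a b (ltW a0) ab; first by rewrite ha hb.
  have : 1 + t = 1 + s.
    by apply: ln_inj; rewrite ?posrE ?lt ?ls//; lra.
  lra.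
move=> b [b0 hb].
have {}hb : h b = 0 by rewrite /h hb subrr.
have [cb|bc|//] := ltgtP c b.
- by exfalso; apply: (aux c b) => //; lra.
- by exfalso; apply: (aux b c) => //; lra.
Qed.

End constant.

(** * A smooth function with prescribed descent points *)

Lemma is_derive_quadratic (R : realType) (f : R -> R) (x d : R) :
  (forall h, `|f (h + x) - f x - h * d| <= h ^+ 2) -> is_derive x (1 : R) f d.
Proof.
move=> fd.
have l : h^-1 *: (f (h *: (1 : R) + x) - f x) @[h --> 0^'] --> d.
  apply/cvgrPdist_le => e e0; near=> h.
  have h0 : h != 0 by near: h; exact: nbhs_dnbhs_neq.
  have hn : 0 < `|h| by rewrite normr_gt0.
  rewrite distrC -(ler_pM2l hn) -normrM.
  rewrite /GRing.scale/= mulrBr mulrA divff// mul1r mulr1.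
  rewrite (le_trans (fd h))// -real_normK ?num_real// expr2 ler_wpM2l//.
  near: h; apply: dnbhs0_le; exact: e0.
apply: DeriveDef; first by apply/cvg_ex; exists d.
exact/cvg_lim.
Unshelve. all: by end_near. Qed.

Section comb.
Context {R : realType}.
Variable y : nat -> R.

Definition pos (x : R) : R := Num.max x 0.

Lemma pos_id x : 0 <= x -> pos x = x.
Proof. by move=> x0; rewrite /pos max_l. Qed.

Lemma pos_eq0 x : x <= 0 -> pos x = 0.
Proof. by move=> x0; rewrite /pos max_r. Qed.

Lemma is_derive_sqr_pos (x : R) :
  is_derive x (1 : R) (fun t : R => pos t ^+ 2) (2 * pos x).
Proof.
apply: is_derive_quadratic => h; rewrite /pos.
have [x0|x0] := leP x 0; have [h0|h0] := leP (h + x) 0.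
- by rewrite !expr0n/= !mulr0 !subr0 normr0 sqr_ge0.
- rewrite expr0n/= !mulr0 !subr0 ger0_norm ?sqr_ge0// ler_sqr ?nnegrE; lra.
- rewrite expr0n/= (_ : _ - _ = - (x * (x + 2 * h))); last ring.
  rewrite normrN ler_norml; apply/andP; split; nra.
- by rewrite (_ : _ - _ = h ^+ 2); [rewrite ger0_norm ?sqr_ge0|ring].
Qed.

Definition mid n := (y n + y n.+1) / 2.

(** The distance from [x] to the union of the half-line below [y 0] and of
    [y 1, ..., y n]: it grows with slope 1 after [y n], so a new node turns the
    slope to -1 at the midpoint and back to 1 at the node.  Positive parts make
    the antiderivative [comb_int] explicit. *)
Fixpoint comb n x : R :=
  if n is m.+1 then comb m x - 2 * pos (x - mid m) + 2 * pos (x - y m.+1)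
  else pos (x - y 0).

Fixpoint comb_int n x : R :=
  if n is m.+1 then
    comb_int m x - pos (x - mid m) ^+ 2 + pos (x - y m.+1) ^+ 2
  else pos (x - y 0) ^+ 2 / 2.

Lemma is_derive_comb_int n (x : R) :
  is_derive x (1 : R) (comb_int n) (comb n x).
Proof.
have sh (a : R) : is_derive x (1 : R) (fun t : R => pos (t - a) ^+ 2)
    (2 * pos (x - a)).
  apply: is_derive_eq.
    apply: (@is_derive1_comp R (fun t => pos t ^+ 2) (fun t => t - a)).
    exact: is_derive_sqr_pos.
  by rewrite subr0 mulr1.
elim: n => [|n IHn] /=.
  have s0 := sh (y 0).
  apply: is_derive_eq.
  by rewrite /GRing.scale/=; field.
have s1 := sh (mid n); have s2 := sh (y n.+1).
have s3 := is_deriveB IHn s1.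
exact: is_deriveD s3 s2.
Qed.

Hypothesis y_lt : forall n, y n < y n.+1.

Lemma y_le m n : (m <= n)%N -> y m <= y n.
Proof.
move=> /subnKC <-; elim: (n - m)%N => [|k IH]; first by rewrite addn0.
by rewrite addnS (le_trans IH)// ltW.
Qed.

Lemma mid_gt n : y n < mid n < y n.+1.
Proof. by have := y_lt n; rewrite /mid => ?; apply/andP; split; lra. Qed.

Lemma combE_right n x : y n <= x -> comb n x = x - y n.
Proof.
elim: n x => [|n IHn] x yx /=; first by rewrite pos_id ?subr_ge0.
have /andP[m1 m2] := mid_gt n.
rewrite IHn; last lra.
rewrite !pos_id; [|lra|lra].
by rewrite /mid; lra.
Qed.

Lemma combSl n x : x <= mid n -> comb n.+1 x = comb n x.
Proof.
move=> xm /=; have /andP[m1 m2] := mid_gt n.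
by rewrite !pos_eq0; [|lra|lra]; rewrite !mulr0 subr0 addr0.
Qed.

Lemma combSr n x : mid n <= x -> comb n.+1 x = `|x - y n.+1|.
Proof.
move=> xm /=; have /andP[m1 m2] := mid_gt n.
rewrite combE_right; last lra.
rewrite (@pos_id (x - mid n)); last lra.
have [xy|yx] := leP x (y n.+1).
  by rewrite pos_eq0 ?ler0_norm; rewrite ?subr_le0//; rewrite /mid; lra.
rewrite pos_id ?gtr0_norm ?subr_gt0//; last lra.
by rewrite /mid; lra.
Qed.

Lemma comb_at_node n k : (k <= n)%N -> comb n (y k) = 0.
Proof.
elim: n => [|n IHn]; first by rewrite leqn0 => /eqP ->; rewrite combE_right ?subrr.
rewrite leq_eqVlt => /predU1P[->|]; first by rewrite combE_right ?subrr.
rewrite ltnS => kn; rewrite combSl ?IHn//.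
by have /andP[m1 _] := mid_gt n; rewrite (le_trans (y_le kn))// ltW.
Qed.

Lemma comb_lipschitz n x z : `|comb n x - comb n z| <= `|x - z|.
Proof.
elim: n x z => [|n IHn] x z /=.
  rewrite /pos; case: (leP (x - y 0) 0) => ?; case: (leP (z - y 0) 0) => ?;
    rewrite ler_norml; have := ler_norm (x - z); have := ler_norm (z - x);
    rewrite (distrC z x) => ? ?; apply/andP; split; lra.
wlog xz : x z / x <= z => [W|].
  by have [/W//|/ltW/W] := leP x z; rewrite distrC (distrC z).
change (`|comb n.+1 x - comb n.+1 z| <= `|x - z|).
have [zm|mz] := leP z (mid n).
  by rewrite !combSl// (le_trans xz).
have [xm|mx] := leP x (mid n).
  have c1 := IHn x (mid n).
  rewrite -[comb n (mid n)]combSl// combSr// in c1.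
  rewrite combSl// combSr ?(ltW mz)//.
  have := ler_dist_dist (mid n - y n.+1) (z - y n.+1).
  rewrite [mid n - _ - _](_ : _ = mid n - z); last lra.
  rewrite [`|mid n - z|]ltr0_norm ?subr_lt0// => c2.
  rewrite [`|x - mid n|]ler0_norm ?subr_le0// in c1.
  rewrite [`|x - z|]ler0_norm ?subr_le0//.
  rewrite (le_trans (ler_distD `|mid n - y n.+1| _ _))//; lra.
rewrite !combSr ?(ltW mz) ?(ltW mx)// (le_trans (ler_dist_dist _ _))//.
by rewrite opprB addrA subrK.
Qed.

Lemma comb_int_right n x : y n <= x ->
  comb_int n x = comb_int n (y n) + (x - y n) ^+ 2 / 2.
Proof.
elim: n x => [|n IHn] x yx /=.
  by rewrite subrr !pos_id ?subr_ge0// expr0n/= mul0r add0r.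
have /andP[m1 m2] := mid_gt n.
rewrite IHn; last lra.
rewrite (IHn (y n.+1)); last lra.
rewrite !pos_id; [|lra..].
by rewrite /mid; field.
Qed.

Lemma comb_int_node n : comb_int n (y n) = \sum_(k < n) (y k.+1 - y k) ^+ 2 / 4.
Proof.
elim: n => [|n IHn] /=; first by rewrite big_ord0 subrr /pos maxxx expr0n mul0r.
have /andP[m1 m2] := mid_gt n.
rewrite big_ord_recr/= comb_int_right ?IHn; last exact: ltW.
rewrite !pos_id; [|lra..].
by rewrite /mid; field.
Qed.

(** Before the midpoint of two nodes, and after the last node, the profile is a
    convex parabola, which dips at most [e ^ 2 / (2 l)] below its value at the
    left node; between midpoint and right node it is concave, hence minimal at
    the ends. *)
Lemma profile_ge n (e l b : R) : 0 < e -> 0 < l ->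
  (forall k, (k <= n)%N -> b <= - e * (y k - y 0) + l * comb_int k (y k)) ->
  forall x, b - e ^+ 2 / (2 * l) <= - e * (x - y 0) + l * comb_int n x.
Proof.
move=> e0 l0; set d := e ^+ 2 / (2 * l).
have sq w : - d <= - e * w + l * (w ^+ 2 / 2).
  have -> : - e * w + l * (w ^+ 2 / 2) = (l * w - e) ^+ 2 / (2 * l) - d.
    rewrite /d; field; lra.
  by rewrite lerBrDl subrr divr_ge0 ?sqr_ge0//; lra.
have d0 : 0 <= d by rewrite divr_ge0 ?sqr_ge0//; lra.
elim: n => [|n IHn] hb x.
  have := hb 0%N isT; rewrite /= !subrr pos_id// expr0n/= mul0r !mulr0 addr0 => b0.
  have [x0|x0] := leP x (y 0).
    rewrite pos_eq0 ?subr_le0// expr0n/= mul0r mulr0 addr0.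
    have : 0 <= e * (y 0 - x) by rewrite mulr_ge0 ?subr_ge0// ltW.
    lra.
  rewrite (@pos_id (x - y 0)); last lra.
  have := sq (x - y 0); lra.
have {IHn}IH : forall x, b - d <= - e * (x - y 0) + l * comb_int n x.
  by apply: IHn => k kn; apply: hb; exact: leqW.
have bS := hb n.+1 (leqnn _).
have bn := hb n (leqnSn _).
have /andP[m1 m2] := mid_gt n.
have [xm|mx] := leP x (mid n).
  have -> : comb_int n.+1 x = comb_int n x.
    by rewrite /= !pos_eq0; [|lra..]; rewrite !expr0n/= subr0 addr0.
  exact: IH.
have [yx|xy] := leP (y n.+1) x.
  rewrite comb_int_right//; have := sq (x - y n.+1); lra.
set u := y n.+1 - x; set m := (y n.+1 - y n) / 2.
have u0 : 0 < u by rewrite /u; lra.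
have um : u <= m by move: mx; rewrite /u /m /mid; lra.
have ES : comb_int n.+1 (y n.+1) = comb_int n (y n) + m ^+ 2.
  by rewrite !comb_int_node big_ord_recr/= /m; field.
have Ex : comb_int n.+1 x = comb_int n (y n) + m ^+ 2 - u ^+ 2 / 2.
  rewrite /= comb_int_right; last lra.
  rewrite pos_id; last lra.
  rewrite pos_eq0; last lra.
  by rewrite /u /m /mid; field.
have [le2|lt2] := leP (l * u) (2 * e).
  have : 0 <= u * (2 * e - l * u) by rewrite mulr_ge0 ?subr_ge0// ltW.
  have : x = y n.+1 - u by rewrite /u; lra.
  rewrite Ex; rewrite ES in bS => ->; lra.
have xE : - e * (x - y 0) = - e * (y n - y 0) - 2 * (e * m) + e * u.
  by rewrite /u /m; field.
rewrite Ex xE.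
(* here the half-step [m] exceeds the abscissa [2 e / l], so the climb from the
   left node outweighs the drop *)
have k1 : 0 <= (m - u) * (l * (m + u) - 2 * e).
  by rewrite mulr_ge0 ?subr_ge0//; have := ler_wpM2l (ltW l0) um; lra.
have k2 : 0 <= u * (l * u - 2 * e) by rewrite mulr_ge0 ?subr_ge0// ltW.
lra.
Qed.

End comb.

(** * AdaGrad steps along a constant gradient *)

Section steps.
Context {R : realType}.
Variable a : R.
Hypothesis a0 : 0 <= a.

(** The length of the step on the [k.+1]-st nonzero sample, for unit [gamma]. *)
Definition wstep (k : nat) : R := (a + Num.sqrt k.+1%:R)^-1.

Lemma wstep_den_gt0 k : 0 < a + Num.sqrt k.+1%:R :> R.
Proof. by rewrite ltr_wpDl// sqrtr_gt0 ltr0n. Qed.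

Lemma wstep_gt0 k : 0 < wstep k.
Proof. by rewrite invr_gt0 wstep_den_gt0. Qed.

Lemma sum_wstep_le_sqrt n : \sum_(k < n) wstep k <= 2 * Num.sqrt n%:R.
Proof.
elim: n => [|n IHn]; first by rewrite big_ord0 mulr_ge0// sqrtr_ge0.
rewrite big_ord_recr/= -lerBrDl.
set u := Num.sqrt n%:R in IHn *; set v := Num.sqrt n.+1%:R.
have u0 : 0 <= u by exact: sqrtr_ge0.
have v0 : 0 < v by rewrite sqrtr_gt0 ltr0n.
have uv : u <= v by rewrite ler_sqrt ?ler_nat// ler0n.
have E : (v - u) * (v + u) = 1.
  rewrite -subr_sqr !sqr_sqrtr ?ler0n// -addn1 natrD; ring.
have : wstep n <= v^-1.
  by rewrite lef_pV2 ?posrE ?wstep_den_gt0// lerDr.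
have : v^-1 <= 2 * (v - u).
  by rewrite -div1r ler_pdivrMr//; have := sqr_ge0 (v - u); nra.
lra.
Qed.

Lemma sum_wstep_le_linear n : \sum_(k < n) wstep k * a <= n%:R.
Proof.
elim: n => [|n IHn]; first by rewrite big_ord0.
rewrite big_ord_recr/= -[n.+1]addn1 natrD lerD//.
by rewrite mulrC ler_pdivrMr ?wstep_den_gt0// mul1r lerDl sqrtr_ge0.
Qed.

(** Since [(a + sqrt k) ^ 2 <= 2 (a ^ 2 + k)], the sum dominates half a harmonic
    sum, in which [1 / D >= ln (1 + 1 / D)] telescopes. *)
Lemma sum_sqr_wstep_ge n :
  ln ((a ^+ 2 + n.+1%:R) / (a ^+ 2 + 1)) / 2 <= \sum_(k < n) wstep k ^+ 2.
Proof.
have a2 : 0 <= a ^+ 2 by exact: sqr_ge0.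
elim: n => [|n IHn].
  by rewrite big_ord0 divff ?ln1 ?mul0r//; lra.
rewrite big_ord_recr/=.
set D := a ^+ 2 + n.+1%:R in IHn *.
have D0 : 0 < D by rewrite ltr_wpDl// ltr0n.
have a1 : 0 < a ^+ 2 + 1 by lra.
have -> : a ^+ 2 + n.+2%:R = D + 1 by rewrite /D -[n.+2]addn1 natrD addrA.
have -> : (D + 1) / (a ^+ 2 + 1) = D / (a ^+ 2 + 1) * (1 + D^-1).
  by field; apply/andP; split; apply: lt0r_neq0.
have Di : 0 < D^-1 by rewrite invr_gt0.
rewrite lnM ?posrE ?divr_gt0//; last lra.
have := @le_ln1Dx R D^-1 ltac:(lra).
have : D^-1 / 2 <= wstep n ^+ 2.
  rewrite /wstep -invfM exprVn lef_pV2 ?posrE ?exprn_gt0 ?wstep_den_gt0//; last lra.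
  have := @sqr_sqrtr R n.+1%:R (ler0n _ _); rewrite /D.
  set v := Num.sqrt _ => <-; have := sqr_ge0 (a - v); lra.
lra.
Qed.

End steps.

Section path.
Context {R : realType}.
Variables (gamma a x1 : R).
Hypotheses (gamma0 : 0 < gamma) (a0 : 0 <= a).

Definition descent_path (n : nat) : R := x1 + gamma * \sum_(k < n) wstep a k.

Lemma descent_pathS n :
  descent_path n.+1 = descent_path n + gamma * wstep a n.
Proof. by rewrite /descent_path big_ord_recr/= mulrDr addrA. Qed.

Lemma descent_path_lt n : descent_path n < descent_path n.+1.
Proof. by rewrite descent_pathS ltrDl mulr_gt0// wstep_gt0. Qed.

Variables (L eps Delta : R).
Hypotheses (L0 : 0 < L) (eps0 : 0 < eps) (Delta0 : 0 < Delta).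

(** The first step length in units of [eps / L]. *)
Definition ratio : R := gamma * L / (eps * (a + 1)).
(** A lower bound for the sum of [L eta ^ 2 / 4] over the steps of length [eta]
    at least [4 eps / L]. *)
Definition climb : R := L * gamma ^+ 2 * ln ratio / 16.
(** The height that may be lost after the climb while staying within
    [Delta / 2] of the initial value. *)
Definition budget : R := climb + Delta / 2.
(** Up to this many steps, descending the path with slope [eps] stays within the
    budget: the two terms come from [sum wstep <= 2 sqrt n] and from
    [sum wstep <= n / a]. *)
Definition horizon : R :=
  Num.max (budget ^+ 2 / (4 * gamma ^+ 2 * eps ^+ 2))
          (budget * a / (gamma * eps)).

Hypothesis ratio16 : 16 <= ratio.

Lemma ln_ratio_gt0 : 0 < ln ratio.
Proof. by apply: ln_gt0; rewrite (lt_le_trans _ ratio16)// ltr1n. Qed.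

Lemma climb_gt0 : 0 < climb.
Proof.
by rewrite /climb divr_gt0// !mulr_gt0 ?exprn_gt0 ?ln_ratio_gt0.
Qed.

Lemma budget_gt0 : 0 < budget.
Proof. by rewrite /budget addr_gt0 ?climb_gt0// divr_gt0. Qed.

Lemma horizon_gt0 : 0 < horizon.
Proof.
rewrite /horizon lt_max divr_gt0// ?exprn_gt0 ?budget_gt0//.
by rewrite !mulr_gt0 ?exprn_gt0.
Qed.

Lemma descent_le_budget n : n%:R <= horizon ->
  eps * (gamma * \sum_(k < n) wstep a k) <= budget.
Proof.
have G0 := budget_gt0; have [e0 g0] := (eps0, gamma0).
have eg : 0 < eps * gamma by rewrite mulr_gt0.
rewrite /horizon le_max => /orP[nH|nH].
  have := sum_wstep_le_sqrt a0 n.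
  set S := \sum_(_ < _) _ => SH.
  have nG : Num.sqrt n%:R <= budget / (2 * gamma * eps).
    have b0 : 0 <= budget / (2 * gamma * eps).
      by rewrite divr_ge0 ?(ltW G0)// !mulr_ge0 ?ltW.
    rewrite -[leRHS]ger0_norm// -sqrtr_sqr ler_sqrt ?sqr_ge0//.
    by rewrite (le_trans nH)// le_eqVlt; apply/orP; left; apply/eqP; field; lra.
  rewrite mulrA (le_trans (ler_wpM2l (ltW eg) SH))//.
  rewrite (_ : budget = eps * gamma * (2 * (budget / (2 * gamma * eps)))).
    by rewrite ler_pM2l// ler_pM2l.
  by field; lra.
have [->|n0] := posnP n; first by rewrite big_ord0 !mulr0 ltW.
have a_gt0 : 0 < a.
  rewrite lt_neqAle a0 andbT; apply/eqP => a_eq0.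
  by move: nH; rewrite -a_eq0 mulr0 mul0r leNgt ltr0n n0.
have := sum_wstep_le_linear a0 n; rewrite -mulr_suml => Sn.
rewrite mulrA -ler_pdivlMl// -(ler_pM2r a_gt0) (le_trans Sn)// (le_trans nH)//.
by rewrite le_eqVlt; apply/orP; left; apply/eqP; field; lra.
Qed.

(** [K] counts the steps of length at least [4 eps / L]. *)
Lemma climb_le K : K = Num.truncn ((gamma * L / (4 * eps) - a) ^+ 2) ->
  climb <= L * gamma ^+ 2 / 4 * \sum_(k < K) wstep a k ^+ 2.
Proof.
have [e0 g0 A0] := And3 eps0 gamma0 a0.
move=> KE; set X := ratio; set B := gamma * L / (4 * eps) in KE.
have X16 : 16 <= X by [].
have BE : B = X * (a + 1) / 4 by rewrite /B /X /ratio; field; lra.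
have /andP[_] := truncn_itv (sqr_ge0 (B - a)); rewrite -KE => BK.
set Y := (a ^+ 2 + K.+1%:R) / (a ^+ 2 + 1).
have a1 : 0 < a ^+ 2 + 1 by rewrite ltr_wpDl ?sqr_ge0.
(* [ln X / 2 <= ln Y] is what is needed, and [X <= Y ^ 2] holds because
   [Y >= X ^ 2 / 32] and [X >= 16] *)
have XY : X ^+ 2 / 32 <= Y.
  rewrite ler_pdivlMr//.
  have B2 : B ^+ 2 / 2 <= a ^+ 2 + (B - a) ^+ 2.
    by have := sqr_ge0 (B - 2 * a); lra.
  have : X ^+ 2 / 32 * (a ^+ 2 + 1) <= B ^+ 2 / 2.
    rewrite BE; have : 0 <= X ^+ 2 * a by rewrite mulr_ge0 ?sqr_ge0.
    lra.
  lra.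
have X2 : 16 * X <= X ^+ 2 by rewrite expr2 ler_wpM2r//; lra.
have Y8 : 8 <= Y by lra.
have XYY : X <= Y ^+ 2.
  have : 8 * Y <= Y * Y by rewrite ler_wpM2r//; lra.
  by rewrite expr2; lra.
have lnXY : ln X / 4 <= \sum_(k < K) wstep a k ^+ 2.
  apply: le_trans (sum_sqr_wstep_ge a0 K); rewrite -/Y.
  have : ln X <= ln (Y ^+ 2) by rewrite ler_ln ?posrE ?exprn_gt0//; lra.
  by rewrite lnXn; lra.
rewrite /climb -/X.
have Lg : 0 <= L * gamma ^+ 2 / 4.
  by rewrite divr_ge0// mulr_ge0 ?sqr_ge0// ltW.
by have := ler_wpM2l Lg lnXY; lra.
Qed.

(** A step of length [eta] changes the height by [L eta ^ 2 / 4 - eps eta], which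
    is a gain for the first [K] steps, those at least [4 eps / L] long.  Beyond
    them the terms [L eta ^ 2 / 4] add up to at least [climb], and the terms
    [eps eta] to at most the budget. *)
Lemma energy_ge n : n%:R <= horizon ->
  - (Delta / 2) <= - eps * (descent_path n - descent_path 0) +
    L * \sum_(k < n) (descent_path k.+1 - descent_path k) ^+ 2 / 4.
Proof.
have [e0 g0 A0] := And3 eps0 gamma0 a0.
have [r16 D0] := (ratio16, Delta0).
move=> nH.
have -> : descent_path n - descent_path 0 = gamma * \sum_(k < n) wstep a k.
  by rewrite /descent_path big_ord0 mulr0 addr0 addrC addKr.
have -> : L * (\sum_(k < n) (descent_path k.+1 - descent_path k) ^+ 2 / 4) =
    L * gamma ^+ 2 / 4 * \sum_(k < n) wstep a k ^+ 2.
  rewrite !mulr_sumr; apply: eq_bigr => k _.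
  by rewrite descent_pathS (addrC (descent_path k)) addrK; field.
set B := gamma * L / (4 * eps); set K := Num.truncn ((B - a) ^+ 2).
have KP := climb_le (erefl K).
have Lg : 0 <= L * gamma ^+ 2 / 4.
  by rewrite divr_ge0// mulr_ge0 ?sqr_ge0// ltW.
have [nK|Kn] := leqP n K.
  rewrite mulNr mulrA !mulr_sumr addrC -sumrB.
  rewrite (@le_trans _ _ 0)//; first by rewrite oppr_le0 divr_ge0// ltW.
  apply: sumr_ge0 => k _.
  have Ba : a <= B.
    rewrite -subr_ge0 (_ : B - a = (ratio * (a + 1) - 4 * a) / 4); last first.
      by rewrite /B /ratio; field; lra.
    by have := ler_wpM2r (addr_ge0 a0 ler01) ratio16; lra.
  have wB : a + Num.sqrt k.+1%:R <= B.
    rewrite -lerBrDl -[leRHS]ger0_norm ?subr_ge0// -sqrtr_sqr ler_sqrt ?sqr_ge0//.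
    by rewrite -truncn_ge_nat ?sqr_ge0// (leq_trans _ nK).
  have w0 := wstep_gt0 a0 k; have d0 := wstep_den_gt0 a0 k.
  have : B^-1 <= wstep a k.
    by rewrite lef_pV2 ?posrE// (lt_le_trans d0).
  have gL : 0 < gamma * L by rewrite mulr_gt0.
  rewrite /B invf_div ler_pdivrMr// => ww.
  have : 0 <= wstep a k * gamma * (wstep a k * (gamma * L) - 4 * eps).
    by rewrite mulr_ge0 ?subr_ge0// mulr_ge0// ltW.
  lra.
have : climb <= L * gamma ^+ 2 / 4 * \sum_(k < n) wstep a k ^+ 2.
  apply: (le_trans KP); rewrite ler_wpM2l//.
  rewrite -!(big_mkord xpredT (fun k => wstep a k ^+ 2)).
  rewrite [leRHS](@big_cat_nat _ _ _ K)//= ?(ltnW Kn)// lerDl.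
  by apply: sumr_ge0 => k _; exact: sqr_ge0.
have := descent_le_budget nH; rewrite /budget; lra.
Qed.

End path.

(** * The trajectory of AdaGrad depends only on the number of nonzero samples *)

Section trajectory.
Context {R : realType}.
Variables (q eps : R) (df : R -> R).

(** Sparsifying only the small gradients keeps the [p]-th moment of the noise
    bounded by its value at a gradient of size [eps]; the points of the
    trajectory up to the horizon all have gradient [- eps]. *)
Definition sparse_oracle (x : R) (b : bool) : R :=
  if `|df x| <= eps then (if b then df x / q else 0) else df x.

Definition hits (r : nat -> bool) (t : nat) : nat := \sum_(i < t) r i.

Lemma hitsS r t : hits r t.+1 = (hits r t + r t)%N.
Proof. by rewrite /hits big_ord_recr. Qed.

Lemma hits_le r s t : (s <= t)%N -> (hits r s <= hits r t)%N.
Proof.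
move=> /subnKC <-; elim: (t - s)%N => [|k IH]; first by rewrite addn0.
by rewrite addnS hitsS (leq_trans IH)// leq_addr.
Qed.

Hypotheses (q0 : 0 < q) (eps0 : 0 < eps).
Variables (gamma lambda x1 : R) (N : nat).
Hypotheses (gamma0 : 0 < gamma) (lambda0 : 0 <= lambda).

Let a := lambda * q / eps.
Let y := descent_path gamma a x1.

Hypothesis df_path : forall k, (k <= N)%N -> df (y k) = - eps.

(** A null sample changes neither the point nor the accumulator, and after [n]
    nonzero samples [- eps / q] the accumulator is [n (eps / q) ^ 2]. *)
Lemma adagrad_descent_path r t : (hits r t <= N)%N ->
  adagrad gamma lambda sparse_oracle x1 r t =
  (y (hits r t), (hits r t)%:R * (eps / q) ^+ 2).
Proof.
elim: t => [|t IHt] ht.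
  by rewrite /hits big_ord0 /= mul0r /y /descent_path big_ord0 mulr0 addr0.
have {}IHt := IHt (leq_trans (hits_le r (leqnSn t)) ht).
rewrite /= IHt; move: ht; rewrite hitsS; set n := hits r t.
have a0 : 0 <= a by rewrite divr_ge0 ?mulr_ge0// ltW.
case: (r t); rewrite ?addn1 ?addn0 => nN; last first.
  rewrite /sparse_oracle.
  rewrite df_path// normrN gtr0_norm// lexx.
  by rewrite expr0n/= mulr0 subr0 addr0.
rewrite /sparse_oracle df_path ?(ltnW nN)// normrN gtr0_norm// lexx.
have -> : n%:R * (eps / q) ^+ 2 + (- eps / q) ^+ 2 = n.+1%:R * (eps / q) ^+ 2.
  by rewrite -[n.+1]addn1 natrD mulrDl mul1r mulNr sqrrN.
congr pair; rewrite /y descent_pathS; congr (_ + _).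
rewrite sqrtrM ?ler0n// sqrtr_sqr gtr0_norm ?divr_gt0//.
have d0 := wstep_den_gt0 a0 n; move: d0; rewrite /wstep /a.
set v := Num.sqrt _ => d0.
have d1 : 0 < lambda + v * (eps / q).
  rewrite (_ : _ + _ = (lambda * q / eps + v) * (eps / q)).
    by rewrite mulr_gt0// divr_gt0.
  by field; rewrite !gt_eqF.
have [d0' d1'] := (lt0r_neq0 d0, lt0r_neq0 d1).
have [e1 q1] := (lt0r_neq0 eps0, lt0r_neq0 q0).
field; rewrite e1 q1/= andbT.
rewrite (_ : _ + _ = (lambda + v * (eps / q)) * q); first exact: mulf_neq0.
by field.
Qed.

(** An affine function of the number of hits lies below the indicator of the
    event that the horizon is not yet reached; its expectation only depends on
    the marginal laws of the seeds. *)
Lemma grad_lower_bound (H : R) r t : 0 < H -> N = Num.truncn H ->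
  eps * (1 - (hits r t)%:R / H) <=
  `|df (adagrad_x gamma lambda sparse_oracle x1 r t)|.
Proof.
move=> H0 NE; have [hH|Hh] := leP (hits r t)%:R H.
  have hN : (hits r t <= N)%N by rewrite NE truncn_ge_nat// ltW.
  rewrite /adagrad_x adagrad_descent_path/= // df_path//.
  rewrite normrN gtr0_norm// ger_pMr// gerBl.
  by rewrite divr_ge0// ltW.
rewrite (le_trans _ (normr_ge0 _))// pmulr_rle0// subr_le0.
by rewrite ler_pdivlMr// mul1r ltW.
Qed.

Lemma avg_grad_lower_bound (H : R) r T : 0 < H -> N = Num.truncn H ->
  (0 < T)%N ->
  eps * (1 - (hits r T)%:R / H) <=
  T%:R^-1 * \sum_(t < T) `|df (adagrad_x gamma lambda sparse_oracle x1 r t)|.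
Proof.
move=> H0 NE T0; rewrite ler_pdivlMl ?ltr0n//.
have -> c : T%:R * c = \sum_(t < T) c by rewrite sumr_const card_ord mulr_natl.
apply: ler_sum => t _; apply: le_trans (grad_lower_bound r t H0 NE).
rewrite ler_pM2l// lerD2l lerN2 ler_pM2r ?invr_gt0// ler_nat.
exact/hits_le/ltnW.
Qed.

End trajectory.

(** * Expectations *)

Section probability_bounds.
Context {R : realType}.

Lemma expectation_bernoulli (theta : R) (X : bool -> R) : 0 <= theta <= 1 ->
  ('E_(bernoulli_prob theta)[X] =
   (theta * X true + (1 - theta) * X false)%:E)%E.
Proof.
move=> t01; rewrite unlock integralE !integral_bernoulli_prob//=.
rewrite !funeposE !funenegE -!EFin_max -!EFinM -!EFinD.
congr EFin; rewrite /unstable.onem.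
have mx (u : R) : Num.max u 0 - Num.max (- u) 0 = u.
  by case: (leP u 0) => ?; case: (leP (- u) 0) => ?; lra.
by rewrite -[in RHS](mx (X true)) -[in RHS](mx (X false)); ring.
Qed.

(** As [h] need not be measurable, it is compared with the measurable
    function [max 0 (e (1 - n / H))] of the number [n] of hits, whose expectation is at
    least [e - e E[n] / H = e - e theta T / H]. *)
Lemma markov_hits d (Om : measurableType d) (P : probability Om R)
    (r : nat -> {RV P >-> bool}) (theta e H : R) (T : nat) (h : Om -> R) :
  0 < e -> 0 < H ->
  (forall n, P (r n @^-1` [set true]) = theta%:E) ->
  (forall w, 0 <= h w) ->
  (forall w, e * (1 - (hits (fun t => r t w) T)%:R / H) <= h w) ->
  ('E_P[h] < (e / 2)%:E)%E -> H <= 2 * theta * T%:R.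
Proof.
move=> e0 H0 Pr h0 hlb Eh.
pose n w := (hits (fun t => r t w) T)%:R : R.
pose k w := Num.max 0 (e * (1 - n w / H)).
have mpre i : measurable (r i @^-1` [set true]).
  by rewrite -[X in measurable X]setTI; exact: measurable_funPT.
have rE i : (fun w => (r i w)%:R : R) = \1_(r i @^-1` [set true]).
  apply/funext => w; rewrite indicE; congr (nat_of_bool _)%:R.
  by apply/idP/idP; rewrite inE.
have mr i : measurable_fun setT (fun w => (r i w)%:R : R).
  by rewrite rE; exact: measurable_indic.
have mn : measurable_fun setT n.
  rewrite (_ : n = fun w => \sum_(i < T) (r i w)%:R).
    exact: measurable_sum.
  by apply/funext => w; rewrite /n /hits natr_sum.
have mk : measurable_fun setT k.
  apply: measurable_maxr => //.
  apply: measurable_funM => //.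
  apply: measurable_funB => //.
  exact: measurable_funM.
have En : (\int[P]_w (n w)%:E = (theta * T%:R)%:E)%E.
  under eq_integral do rewrite /n /hits natr_sum -sumEFin.
  rewrite ge0_integral_sum//; last first.
    by move=> i; exact/measurable_EFinP.
  rewrite (eq_bigr (fun=> theta%:E)) => [|i _].
    by rewrite sumEFin sumr_const card_ord mulr_natr.
  have := integral_indic P measurableT (mpre i).
  rewrite setIT => E1; rewrite -(Pr i) -[RHS]E1.
  by apply: eq_integral => w _; rewrite -rE.
have Ek : (\int[P]_w (k w)%:E <= 'E_P[h])%E.
  rewrite unlock !ge0_integralTE; last 2 first.
  - by move=> w; rewrite lee_fin.
  - by move=> w; rewrite lee_fin /k le_max lexx.
  apply: ereal_sup_le => _ [f /= fk <-]; exists f => //= w.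
  by rewrite (le_trans (fk w))// lee_fin /k ge_max h0 hlb.
have : (e%:E <= \int[P]_w ((k w)%:E + (e / H)%:E * (n w)%:E))%E.
  rewrite -[leLHS]mule1 -(@probability_setT _ _ _ P) -integral_cst//.
  apply: ge0_le_integral => //.
  - by move=> w _; rewrite lee_fin ltW.
  - apply: emeasurable_funD; first exact/measurable_EFinP.
    by apply: measurable_funeM; exact/measurable_EFinP.
  - move=> w _; rewrite -EFinM -EFinD lee_fin /k -lerBlDr le_max.
    apply/orP; right; rewrite le_eqVlt; apply/orP; left; apply/eqP; field.
    exact: lt0r_neq0.
rewrite ge0_integralD//=; last 4 first.
  - by move=> w _; rewrite lee_fin /k le_max lexx.
  - exact/measurable_EFinP.
  - by move=> w _; rewrite -EFinM lee_fin mulr_ge0// divr_ge0// ltW.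
  - by apply: measurable_funeM; exact/measurable_EFinP.
rewrite ge0_integralZl_EFin//; last 3 first.
  - by move=> w _; rewrite lee_fin ler0n.
  - exact/measurable_EFinP.
  - by rewrite divr_ge0// ltW.
rewrite En -EFinM => le1.
have : (e%:E < (e / 2)%:E + (e / H * (theta * T%:R))%:E)%E.
  apply: (le_lt_trans le1); rewrite lteD2rE//.
  exact: le_lt_trans Eh.
rewrite -EFinD lte_fin => lt1.
have : e / H * (H - 2 * theta * T%:R) < 0.
  rewrite mulrBr divfK ?lt0r_neq0//; lra.
by rewrite pmulr_rlt0 ?divr_gt0// subr_lt0 => /ltW.
Qed.

End probability_bounds.

(** * Powers of the noise level *)

Section noise.
Context {R : realType}.
Variable p : R.
Hypotheses (p1 : 1 < p) (p2 : p <= 2).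

(** Young's inequality for [x ^ al] and [1], with exponents [1 / al] and
    [1 / (1 - al)]. *)
Lemma powR_le_tangent (al x : R) : 0 < al -> al <= 1 -> 0 <= x ->
  x `^ al <= 1 + al * (x - 1).
Proof.
move=> a0; rewrite le_eqVlt => /predU1P[-> x0|a1 x0].
  by rewrite powRr1// mul1r addrC subrK.
have b0 : 0 < 1 - al by rewrite subr_gt0.
have := @conjugate_powR R (x `^ al) 1 al^-1 (1 - al)^-1 (powR_ge0 _ _) ler01.
rewrite !invr_gt0 !invrK => /(_ a0 b0); rewrite addrC subrK => /(_ erefl).
rewrite mulr1 powR1 -powRrM divff ?gt_eqF// powRr1//; lra.
Qed.

Section fixed_noise.
Variables sigma eps : R.
Hypotheses (sigma0 : 0 <= sigma) (eps0 : 0 < eps).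

Let q := q_of p sigma eps.
Let b := 1 + (p - 1) / 4 * (2 * sigma / eps) `^ p.

Let b1 : 1 <= b.
Proof.
rewrite /b lerDl mulr_ge0 ?powR_ge0// divr_ge0// subr_ge0; exact: ltW.
Qed.

Let p10 : 0 < p - 1. Proof. by rewrite subr_gt0. Qed.

Lemma q_of_gt0 : 0 < q.
Proof. by apply: powR_gt0; rewrite -/b (lt_le_trans _ b1). Qed.

Lemma q_ofV : q^-1 = b `^ (1 / (p - 1)).
Proof. by rewrite /q /q_of -/b powRN invrK. Qed.

Lemma q_of_le1 : q <= 1.
Proof.
rewrite -[leRHS]invr1 -[leLHS]invrK q_ofV lef_pV2 ?posrE//.
- by rewrite -[leLHS](powRr0 b) ler_powR// divr_ge0// ltW.
- by rewrite powR_gt0// (lt_le_trans _ b1).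
Qed.

Lemma q_of_powR : q `^ (p - 1) = b^-1.
Proof.
rewrite /q /q_of -/b -powRrM mulNr divfK ?gt_eqF//.
by rewrite powR_inv1// (le_trans _ b1).
Qed.

(** With [V = (1 - q) ^ (p - 1)] and [Q = q ^ (p - 1)], the moment is
    [u ^ p (1 - q) (V + Q) / Q].  The tangent inequality at [q] bounds
    [(1 - q) / Q], and at [2 q] and [2 (1 - q)] it bounds [V + Q]. *)
Lemma sparse_noise u : 0 <= u -> u <= eps ->
  q * (u / q - u) `^ p + (1 - q) * u `^ p <= sigma `^ p.
Proof.
move=> u0 ue; have [q0 q1] := (q_of_gt0, q_of_le1); have P1 := p10.
have P2 := p2; have B1 := b1.
set Q := q `^ (p - 1); set V := (1 - q) `^ (p - 1).
have QE : Q = b^-1 by exact: q_of_powR.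
have q1' : 0 <= 1 - q by rewrite subr_ge0.
have tp : 2 `^ p = 2 * 2 `^ (p - 1) :> R by rewrite mulr_powRB1//; lra.
have VQ : (V + Q) * 2 `^ p <= 4.
  have := @powR_le_tangent (p - 1) (2 * q) p10 ltac:(lra) ltac:(lra).
  have := @powR_le_tangent (p - 1) (2 * (1 - q)) p10 ltac:(lra) ltac:(lra).
  rewrite !powRM//; last exact: ltW.
  rewrite -/Q -/V tp; lra.
have Qb : Q * b = 1 by rewrite QE mulVf//; lra.
set w := (2 * sigma / eps) `^ p.
have w0 : 0 <= w by exact: powR_ge0.
have qb : (1 - q) * b <= w / 4.
  have := @powR_le_tangent (p - 1) q p10 ltac:(lra) (ltW q0); rewrite -/Q => le.
  rewrite -(ler_pM2l p10).
  have : ((p - 1) * (1 - q)) * b <= (1 - Q) * b by rewrite ler_wpM2r//; lra.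
  have -> : (1 - Q) * b = (p - 1) / 4 * w.
    by rewrite mulrBl mul1r Qb /b addrC addKr.
  lra.
have V0 : 0 <= V by exact: powR_ge0.
have Q0 : 0 < Q by rewrite powR_gt0.
have E : q * (u / q - u) `^ p + (1 - q) * u `^ p =
    u `^ p * ((1 - q) * b * (V + Q)).
  rewrite (_ : u / q - u = u * (1 - q) * q^-1); last by field; rewrite gt_eqF.
  have qV0 : 0 <= q^-1 by rewrite invr_ge0 ltW.
  rewrite powRM// ?mulr_ge0// powRM//.
  rewrite -(@mulr_powRB1 _ (1 - q))//; last lra.
  rewrite -(@mulr_powRB1 _ q^-1)//; last lra.
  have -> : q^-1 `^ (p - 1) = b.
    rewrite -(powR_inv1 (ltW q0)) -powRrM mulrC powRrM -/Q QE.
    by rewrite powR_inv1 ?invrK// invr_ge0; lra.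
  rewrite -/V (_ : (1 - q) * b * (V + Q) = (1 - q) * (b * V + Q * b)); last ring.
  rewrite Qb.
  by field; rewrite gt_eqF.
have two0 : 0 < 2 `^ p :> R by rewrite powR_gt0.
have we : w * eps `^ p = 2 `^ p * sigma `^ p.
  rewrite -!powRM//; first by rewrite divfK// gt_eqF.
    by rewrite !mulr_ge0 ?invr_ge0 ?(ltW eps0).
  exact: ltW.
rewrite E -(ler_pM2r two0) [leRHS]mulrC -we.
have up : u `^ p <= eps `^ p.
  by apply: ge0_ler_powR; rewrite ?nnegrE// ?(ltW eps0)//; lra.
rewrite -[leLHS]mulrA [w * _]mulrC; apply: ler_pM => //; first exact: powR_ge0.
  have b0 : 0 <= b by lra.
  by have [Q1 t1] := (ltW Q0, ltW two0); rewrite !mulr_ge0// addr_ge0.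
rewrite -[leLHS]mulrA (le_trans (ler_wpM2r _ qb))//.
  by rewrite mulr_ge0 ?addr_ge0// ltW.
by have := ler_wpM2l w0 VQ; lra.
Qed.

End fixed_noise.

Definition noise_excess (sigma eps : R) : R :=
  sigma `^ (p / (p - 1)) * eps `^ (- (p / (p - 1))).

(** With [w = (sigma / eps) ^ p], [1 / q] is the power [1 / (p - 1)] of
    [1 + c w] for some [c] depending on [p], and the excess is the same power of
    [w]. *)
Lemma q_of_equiv : exists2 kappa : R, 1 <= kappa & forall sigma eps : R,
  0 <= sigma -> 0 < eps ->
  (q_of p sigma eps)^-1 <= kappa * (1 + noise_excess sigma eps) /\
  1 + noise_excess sigma eps <= kappa * (q_of p sigma eps)^-1.
Proof.
have P1 : 0 < p - 1 by rewrite subr_gt0.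
set be := 1 / (p - 1); have be0 : 0 <= be by rewrite divr_ge0// ltW.
set c := (p - 1) / 4 * 2 `^ p.
have c0 : 0 < c by rewrite mulr_gt0 ?divr_gt0 ?powR_gt0.
have cb0 : 0 < c `^ be by rewrite powR_gt0.
exists ((1 + c) `^ be + 1 + (c `^ be)^-1).
  have : 0 <= (c `^ be)^-1 by rewrite invr_ge0 ltW.
  have := powR_ge0 (1 + c) be; lra.
move=> sigma eps s0 e0; rewrite q_ofV//.
set w := (sigma / eps) `^ p; have w0 : 0 <= w by exact: powR_ge0.
have se0 : 0 <= sigma / eps by rewrite divr_ge0// ltW.
have -> : 1 + (p - 1) / 4 * (2 * sigma / eps) `^ p = 1 + c * w.
  by rewrite -(mulrA 2 sigma) powRM// mulrA.
have -> : noise_excess sigma eps = w `^ be.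
  rewrite /noise_excess /w -powRrM (_ : p * be = p / (p - 1)); last first.
    by rewrite /be mul1r.
  rewrite powRM ?invr_ge0 ?(ltW e0)// -(powR_inv1 (ltW e0)) -powRrM.
  by rewrite mulN1r.
set s := w `^ be; have ss : 0 <= s by exact: powR_ge0.
rewrite -/be; set B := (1 + c * w) `^ be.
have cw0 : 0 <= c * w by rewrite mulr_ge0// ltW.
have B1 : 1 <= B by rewrite -[leLHS](powRr0 (1 + c * w)) ler_powR// lerDl.
have cVB0 : 0 < (c `^ be)^-1 by rewrite invr_gt0.
have c1be : 0 <= (1 + c) `^ be by exact: powR_ge0.
have Bup : B <= (1 + c) `^ be * (1 + s).
  have [w1|w1] := leP w 1.
    have : B <= (1 + c) `^ be.
      apply: ge0_ler_powR; rewrite ?nnegrE//; [lra|lra|].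
      by have := ler_wpM2l (ltW c0) w1; lra.
    have := mulr_ge0 c1be ss; lra.
  have : B <= ((1 + c) * w) `^ be.
    by apply: ge0_ler_powR; rewrite ?nnegrE//; lra.
  rewrite powRM//; last lra.
  rewrite -/s; lra.
have Blo : c `^ be * s <= B.
  rewrite /s -(powRM _ (ltW c0) w0).
  by apply: ge0_ler_powR; rewrite ?nnegrE ?lerDr// addr_ge0.
split.
  have := mulr_ge0 (ltW cVB0) ss; lra.
have : s <= (c `^ be)^-1 * B by rewrite ler_pdivlMl.
have := mulr_ge0 c1be (le_trans ler01 B1); lra.
Qed.

End noise.

(** * Comparison of the horizon with the complexity *)

Section numeric.
Context {R : realType}.

(** With [z = 16 eps / (gamma L)] the assumption gives
    [z ^ 2 (a ^ 2 + 1) <= (ln c) ^ 2 / (2 c)], which is at most [1 / 2] because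
    [ln c <= ln (1 + c) = 2 c / (1 + c) <= 8 / 5]; then [z (a + 1) <= 1]. *)
Lemma ratio_ge16 (c gamma L eps a : R) :
  392 / 100 <= c -> c <= 393 / 100 -> c_equation c ->
  0 < gamma -> 0 < L -> 0 < eps -> 0 <= a ->
  16 * eps / (gamma * L) * Num.sqrt (a ^+ 2 + 1) <= ln c / Num.sqrt (2 * c) ->
  16 <= ratio gamma a L eps.
Proof.
move=> c1 c2 [c0 ceq] g0 L0 e0 a0 le.
set z := 16 * eps / (gamma * L) in le.
have z0 : 0 < z by rewrite divr_gt0 ?mulr_gt0.
have zE : z = 16 * eps / (gamma * L) by [].
clearbody z.
have lnc : ln c <= 8 / 5.
  have : ln c <= ln (1 + c) by rewrite ler_ln ?posrE; lra.
  have : ln (1 + c) <= 8 / 5.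
    rewrite -(@ler_pM2l _ (1 + c)); last lra.
    by rewrite -ceq; lra.
  lra.
have lnc0 : 0 <= ln c by apply: ln_ge0; lra.
have A0 : 0 < a ^+ 2 + 1 by rewrite ltr_wpDl ?sqr_ge0.
have : (z * Num.sqrt (a ^+ 2 + 1)) ^+ 2 <= (ln c / Num.sqrt (2 * c)) ^+ 2.
  apply: lerXn2r => //; rewrite nnegrE; last by rewrite divr_ge0// sqrtr_ge0.
  by apply: mulr_ge0; [exact: ltW|exact: sqrtr_ge0].
have s1 := sqr_sqrtr (ltW A0).
have s2 : Num.sqrt (2 * c) ^+ 2 = 2 * c by rewrite sqr_sqrtr//; lra.
rewrite exprMn [(ln c / _) ^+ 2]expr_div_n s1 s2 => zA.
have zA2 : z ^+ 2 * (a ^+ 2 + 1) <= 1 / 2.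
  apply: (le_trans zA); rewrite ler_pdivrMr; last lra.
  have : ln c ^+ 2 <= (8 / 5) ^+ 2 by apply: lerXn2r; rewrite ?nnegrE//; lra.
  lra.
have za : z * (a + 1) <= 1.
  rewrite -ler_sqr ?nnegrE ?mulr_ge0 ?(ltW z0)//; last lra.
  have : 0 <= z ^+ 2 * (a - 1) ^+ 2 by rewrite mulr_ge0 ?sqr_ge0.
  lra.
rewrite /ratio ler_pdivlMr; last by rewrite mulr_gt0//; lra.
move: za; rewrite zE mulrAC ler_pdivrMr ?mulr_gt0// mul1r.
by rewrite mulrA.
Qed.

Lemma complexityE (p Delta L sigma eps gamma lambda : R) :
  1 < p -> 0 < eps ->
  complexity p Delta L sigma eps gamma lambda =
  (lambda * Delta / gamma +
   (Delta ^+ 2 / gamma ^+ 2 +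
    gamma ^+ 2 * L ^+ 2 * ln (M_of p L sigma eps gamma lambda) ^+ 2) *
   (1 + noise_excess p sigma eps)) / eps ^+ 2.
Proof.
move=> p1 e0; have p10 : p - 1 != 0 by rewrite subr_eq0 gt_eqF.
rewrite /complexity /noise_excess; set l := ln _ ^+ 2.
have -> : (3 * p - 2) / (p - 1) = 2%:R + p / (p - 1) by field.
rewrite powRD; last by rewrite (gt_eqF e0) implybT.
rewrite powR_mulrn ?(ltW e0)// powRN [(eps ^+ 2 * _)^-1]invfM.
by ring.
Qed.

(** [M] is the ratio [X] with [1 / q] replaced by the comparable [S], so it lies
    between [X / kappa] and [kappa X]; and [ln X >= 1] absorbs [ln kappa]. *)
Lemma ln_M_bound (p L sigma eps gamma lambda kappa : R) :
  let q := q_of p sigma eps in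
  let S := 1 + noise_excess p sigma eps in
  let X := ratio gamma (lambda * q / eps) L eps in
  0 < q -> 0 < eps -> 0 < gamma -> 0 < L -> 0 <= lambda -> 1 <= kappa ->
  q^-1 <= kappa * S -> S <= kappa * q^-1 -> 16 <= X ->
  ln (M_of p L sigma eps gamma lambda) ^+ 2 <= ((1 + ln kappa) * ln X) ^+ 2.
Proof.
move=> q S X q0 e0 g0 L0 l0 k1 qS Sq X16.
have S0 : 0 < S.
  by rewrite ltr_pwDl// mulr_ge0 ?powR_ge0.
set M := M_of _ _ _ _ _ _.
have D0 : 0 < lambda + eps * S by rewrite ltr_wpDl// mulr_gt0.
have D1 : 0 < lambda * q + eps by rewrite ltr_wpDl// mulr_ge0// ltW.
have ME : M = gamma * L * S / (lambda + eps * S) by [].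
have gL : 0 < gamma * L by rewrite mulr_gt0.
have M0 : 0 < M by rewrite ME divr_gt0// mulr_gt0.
have XE : X = gamma * L / (lambda * q + eps).
  rewrite /X /ratio; congr (_ / _); field; exact: lt0r_neq0.
have qS' : 1 <= kappa * (S * q).
  by move: qS; rewrite -div1r ler_pdivrMr// mulrA.
have Sq' : S * q <= kappa by move: Sq; rewrite ler_pdivlMr.
have lk0 : 0 <= ln kappa by exact: ln_ge0.
have k0 : 0 < kappa by lra.
have X0 : 0 < X by lra.
have lnX1 : 1 <= ln X.
  rewrite -ler_expR lnK ?posrE//.
  have := @expR_le_poly5 R 1 ler01 (lexx _); rewrite !expr1n; lra.
have XD : X * (lambda * q + eps) = gamma * L by rewrite XE divfK// lt0r_neq0.
have up : M <= kappa * X.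
  rewrite ME ler_pdivrMr// -XD.
  have : 0 <= X * (lambda * (kappa - S * q)).
    by rewrite mulr_ge0 ?(ltW X0)// mulr_ge0// subr_ge0.
  have : 0 <= X * ((kappa - 1) * (eps * S)).
    rewrite mulr_ge0 ?(ltW X0)// mulr_ge0 ?subr_ge0//.
    by apply: mulr_ge0; exact: ltW.
  lra.
have lo : X <= kappa * M.
  set m := gamma * L / (lambda + eps * S).
  have m0 : 0 < m by rewrite divr_gt0.
  have -> : M = m * S by rewrite ME /m mulrAC.
  have mD : gamma * L = m * (lambda + eps * S).
    by rewrite /m divfK// lt0r_neq0.
  clearbody m; rewrite XE ler_pdivrMr// mD.
  have : 0 <= m * (lambda * (kappa * (S * q) - 1)).
    by rewrite mulr_ge0 ?(ltW m0)// mulr_ge0// subr_ge0.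
  have : 0 <= m * ((kappa - 1) * (eps * S)).
    rewrite mulr_ge0 ?(ltW m0)// mulr_ge0 ?subr_ge0//.
    by apply: mulr_ge0; exact: ltW.
  lra.
have lup : ln M <= ln kappa + ln X.
  by rewrite -lnM ?posrE// ler_ln ?posrE// mulr_gt0.
have llo : ln X <= ln kappa + ln M.
  by rewrite -lnM ?posrE// ler_ln ?posrE// mulr_gt0.
have kX : ln kappa <= ln kappa * ln X by rewrite ler_peMr.
rewrite -[leLHS]real_normK ?num_real//; apply: lerXn2r.
- by rewrite nnegrE.
- by rewrite nnegrE mulr_ge0//; lra.
- by rewrite ler_norml; apply/andP; split; lra.
Qed.

(** The term [lambda Delta / gamma] comes from the linear part of [horizon], and
    the two others from the square of [budget], which exceeds both
    [Delta ^ 2 / 4] and [climb ^ 2]. *)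
Lemma complexity_le (p Delta L sigma eps gamma lambda kappa T : R) :
  let q := q_of p sigma eps in
  let S := 1 + noise_excess p sigma eps in
  let a := lambda * q / eps in
  1 < p -> 0 < q -> 0 < Delta -> 0 < eps -> 0 < gamma -> 0 < L ->
  0 <= lambda -> 1 <= kappa ->
  q^-1 <= kappa * S -> S <= kappa * q^-1 -> 16 <= ratio gamma a L eps ->
  horizon gamma a L eps Delta <= 2 * q * T ->
  complexity p Delta L sigma eps gamma lambda <=
  (4 + 2048 * kappa * (1 + ln kappa) ^+ 2) * T.
Proof.
move=> q S a p1 q0 D0 e0 g0 L0 l0 k1 qS Sq X16.
rewrite /horizon ge_max => /andP[h1 h2].
set X := ratio gamma a L eps in X16.
have lM := ln_M_bound q0 e0 g0 L0 l0 k1 qS Sq X16.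
rewrite -/q -/a -/X in lM.
have S0 : 0 < S.
  by rewrite ltr_pwDl// mulr_ge0 ?powR_ge0.
have k0 : 0 < kappa by lra.
have lk0 : 0 <= ln kappa by exact: ln_ge0.
have lX : 0 < ln X by apply: ln_gt0; lra.
set cl := L * gamma ^+ 2 * ln X / 16.
have clE : climb gamma a L eps = cl by [].
have cl0 : 0 < cl by rewrite /cl divr_gt0// !mulr_gt0// exprn_gt0.
rewrite /budget clE in h1 h2.
have g2 : 0 < gamma ^+ 2 by rewrite exprn_gt0.
have e2 : 0 < eps ^+ 2 by rewrite exprn_gt0.
rewrite complexityE// -/S ler_pdivrMr//.
set lm := ln _ ^+ 2 in lM *; set K := (1 + ln kappa) ^+ 2.
have K1 : 1 <= K by rewrite -(expr1n _ 2%N) lerXn2r ?nnegrE//; lra.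
have T1 : lambda * Delta / gamma <= 4 * T * eps ^+ 2.
  rewrite ler_pdivrMr//.
  move: h2; rewrite ler_pdivrMr ?mulr_gt0// /a.
  rewrite (_ : _ * (lambda * q / eps) = ((cl + Delta / 2) * lambda) * q / eps);
    last by field; exact: lt0r_neq0.
  rewrite ler_pdivrMr// => h2.
  have : (cl + Delta / 2) * lambda <= 2 * T * (gamma * eps) * eps.
    by rewrite -(ler_pM2r q0); lra.
  have : 0 <= cl * lambda by rewrite mulr_ge0// ltW.
  lra.
have T2 : (cl + Delta / 2) ^+ 2 * S <= 8 * kappa * T * gamma ^+ 2 * eps ^+ 2.
  have Sq' : S * q <= kappa by move: Sq; rewrite ler_pdivlMr.
  move: h1; rewrite ler_pdivrMr; last by rewrite !mulr_gt0.
  move=> h1; have := ler_wpM2r (ltW S0) h1.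
  have T0 : 0 <= T.
    have : 0 <= 2 * q * T * (4 * gamma ^+ 2 * eps ^+ 2).
      exact: le_trans (sqr_ge0 _) h1.
    by rewrite pmulr_lge0 ?pmulr_rge0 ?mulr_gt0.
  have : 0 <= (kappa - S * q) * (8 * T * gamma ^+ 2 * eps ^+ 2).
    by rewrite mulr_ge0 ?subr_ge0// !mulr_ge0// ltW.
  lra.
have T3 : Delta ^+ 2 / gamma ^+ 2 + gamma ^+ 2 * L ^+ 2 * lm <=
    256 * K * (cl + Delta / 2) ^+ 2 / gamma ^+ 2.
  rewrite ler_pdivlMr// mulrDl divfK ?gt_eqF//.
  have c1 : 0 <= gamma ^+ 4 * L ^+ 2 by rewrite mulr_ge0 ?sqr_ge0 ?exprn_ge0 ?ltW.
  have := ler_wpM2l c1 lM; rewrite exprMn -/K => c2.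
  have clX : gamma ^+ 4 * L ^+ 2 * (K * ln X ^+ 2) = 256 * K * cl ^+ 2.
    by rewrite /cl; field.
  rewrite clX in c2.
  have : 0 <= K * (cl * Delta) by rewrite !mulr_ge0 ?ltW//; lra.
  have : 0 <= (K - 1) * Delta ^+ 2 by rewrite mulr_ge0 ?sqr_ge0//; lra.
  have : 0 <= Delta ^+ 2 by exact: sqr_ge0.
  lra.
have := ler_wpM2r (ltW S0) T3.
have : 256 * K * (cl + Delta / 2) ^+ 2 / gamma ^+ 2 * S <=
    2048 * kappa * K * T * eps ^+ 2.
  rewrite mulrAC ler_pdivrMr//.
  have := ler_wpM2l (le_trans ler01 K1) T2; lra.
lra.
Qed.

End numeric.

(** * The hard function and its oracle *)

Section hard_function.
Context {R : realType}.
Variables (y : nat -> R) (N : nat) (L eps : R).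

Definition hard_fun (x : R) : R := - eps * (x - y 0) + L * comb_int y N x.

Lemma is_derive_hard_fun (x : R) :
  is_derive x (1 : R) hard_fun (- eps + L * comb y N x).
Proof.
have dc := is_derive_comb_int y N x.
apply: is_derive_eq.
rewrite /GRing.scale/=; by ring.
Qed.

Lemma derive1_hard_fun x : derive1 hard_fun x = - eps + L * comb y N x.
Proof. by rewrite derive1E; have := is_derive_hard_fun x => -[]. Qed.

Hypothesis y_lt : forall n, y n < y n.+1.

Lemma hard_fun_smooth : 0 < L -> smooth L hard_fun.
Proof.
move=> L0; split=> [x|x z]; first by case: (is_derive_hard_fun x).
rewrite !derive1_hard_fun opprD addrACA subrr add0r -mulrBr normrM gtr0_norm//.
by rewrite ler_pM2l// comb_lipschitz.
Qed.

Lemma derive1_hard_fun_node k : (k <= N)%N -> derive1 hard_fun (y k) = - eps.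
Proof. by move=> kN; rewrite derive1_hard_fun comb_at_node// mulr0 addr0. Qed.

Lemma hard_fun_start : hard_fun (y 0) = 0.
Proof.
rewrite /hard_fun subrr mulr0 add0r.
suff : forall n x, x <= y 0 -> comb_int y n x = 0.
  by move=> ->//; rewrite mulr0.
elim=> [|n IHn] x xy /=.
  by rewrite pos_eq0 ?subr_le0// expr0n/= mul0r.
have y0n : y 0 <= y n by exact: y_le.
have /andP[m1 m2] := mid_gt y_lt n.
by rewrite IHn// !pos_eq0 ?expr0n/= ?subr0 ?addr0//; lra.
Qed.

End hard_function.

Section oracle.
Context {R : realType}.

Lemma sparse_oracle_for (p sigma eps : R) (f : R -> R) :
  1 < p -> p <= 2 -> 0 <= sigma -> 0 < eps ->
  oracle_for p sigma f (sparse_oracle (q_of p sigma eps) eps (derive1 f))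
    (bernoulli_prob (q_of p sigma eps)).
Proof.
move=> p1 p2 s0 e0 x; set q := q_of p sigma eps.
have q0 : 0 < q by exact: q_of_gt0.
have q1 : q <= 1 by exact: q_of_le1.
have q01 : 0 <= q <= 1 by rewrite (ltW q0).
rewrite !expectation_bernoulli// /sparse_oracle; set u := derive1 f x.
case: ifPn => [ue|_]; last first.
  split; first by congr EFin; ring.
  rewrite subrr normr0 powR0; last by rewrite gt_eqF; lra.
  by rewrite !mulr0 addr0 lee_fin powR_ge0.
split; first by congr EFin; field; exact: lt0r_neq0.
rewrite lee_fin sub0r normrN.
have -> : `|u / q - u| = `|u| / q - `|u|.
  have -> : u / q - u = u * (q^-1 - 1) by ring.
  rewrite normrM (@ger0_norm _ (q^-1 - 1)); first by rewrite mulrBr mulr1.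
  by rewrite subr_ge0 -[leLHS]invr1 lef_pV2 ?posrE.
exact: sparse_noise.
Qed.

Lemma zero_oracle_for (p sigma : R) (P : probability bool R) : 0 < p ->
  oracle_for p sigma (fun=> 0) (fun _ _ => 0) P.
Proof.
move=> p0 x.
have -> : derive1 (fun=> 0 : R) x = 0 :> R by exact: derive1_cst.
split; first by rewrite expectation_cst.
under eq_fun do rewrite subrr normr0 powR0 ?gt_eqF//.
by rewrite expectation_cst lee_fin powR_ge0.
Qed.

End oracle.

(** * The lower bound *)

Section hard_instance.
Context {R : realType}.
Variables (Delta L eps x1 gamma a : R).
Hypotheses (Delta0 : 0 < Delta) (L0 : 0 < L) (eps0 : 0 < eps).
Hypotheses (gamma0 : 0 < gamma) (a0 : 0 <= a).
Hypothesis eps_small_gap : eps <= Num.sqrt (Delta * L).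
Hypothesis ratio16 : 16 <= ratio gamma a L eps.

Let y := descent_path gamma a x1.
Let N := Num.truncn (horizon gamma a L eps Delta).

(** Half of [Delta] is spent along the path; the other half covers the dips of
    depth [eps ^ 2 / (2 L)] between the nodes and after the last one. *)
Lemma hard_fun_gap : gap_le Delta (hard_fun y N L eps) x1.
Proof.
have y_lt n : y n < y n.+1 by exact: descent_path_lt.
have y0 : y 0 = x1 by rewrite /y /descent_path big_ord0 mulr0 addr0.
rewrite /gap_le -{1}y0 hard_fun_start// sub0e leeNl.
apply/ereal_infP => _ [x _ <-] /=; rewrite lee_fin.
have e2 : eps ^+ 2 / (2 * L) <= Delta / 2.
  have DL : 0 <= Delta * L by rewrite mulr_ge0 ?ltW.
  have : eps ^+ 2 <= Num.sqrt (Delta * L) ^+ 2.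
    by apply: lerXn2r => //; rewrite nnegrE ?sqrtr_ge0 ?ltW.
  rewrite sqr_sqrtr// => e2; rewrite ler_pdivrMr ?mulr_gt0//.
  by rewrite (_ : Delta / 2 * (2 * L) = Delta * L)//; field.
have H0 : 0 < horizon gamma a L eps Delta by exact: horizon_gt0.
have := @profile_ge R y y_lt N eps L (- (Delta / 2)) eps0 L0 _ x.
rewrite -/(hard_fun y N L eps x) => le; apply: le_trans (le _); first lra.
move=> k kN; rewrite comb_int_node//; apply: energy_ge => //.
by rewrite -truncn_ge_nat// ltW.
Qed.

End hard_instance.

Theorem theoremB1 (R : realType) :
  exists c : R,
  [/\ unique c_equation c, 392 / 100 <= c, c <= 393 / 100 &
  forall p : R, 1 < p -> p <= 2 ->
  exists C : R, 0 < C /\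
  forall Delta L sigma eps x1 gamma lambda : R,
    0 < Delta -> 0 < L -> 0 <= sigma ->
    0 < eps -> eps <= Num.sqrt (2 * Delta * L) ->
    0 < gamma -> 0 <= lambda -> (sigma = 0 -> lambda = 0) ->
  exists (f : R -> R) (g : R -> bool -> R) (theta : R),
    [/\ 0 <= theta <= 1,
        gap_le Delta f x1 /\ smooth L f,
        oracle_for p sigma f g (bernoulli_prob theta) &
        eps_small c p Delta L sigma eps gamma lambda ->
        forall (d : measure_display) (Om : measurableType d)
          (P : probability Om R) (r : nat -> {RV P >-> bool}),
        fresh_samples (bernoulli_prob theta) r ->
        forall T : nat, (0 < T)%N ->
        ('E_P[fun w => avg_grad gamma lambda f g x1 T (fun t => r t w)]
           < (eps / 2)%:E)%E ->
        C * complexity p Delta L sigma eps gamma lambda <= T%:R]].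
Proof.
have [c [cu c1 c2]] := @c_equation_unique R; exists c; split => // p p1 p2.
have [kappa k1 kP] := q_of_equiv p1.
pose C := 4 + 2048 * kappa * (1 + ln kappa) ^+ 2.
have C0 : 0 < C.
  have : 0 <= kappa * (1 + ln kappa) ^+ 2 by rewrite mulr_ge0 ?sqr_ge0//; lra.
  by rewrite /C; lra.
exists C^-1; split=> [|Delta L sigma eps x1 gamma lambda]; first by rewrite invr_gt0.
move=> Delta0 L0 sigma0 eps0 _ gamma0 lambda0 _.
(* without the smallness of [eps] nothing is claimed on [T], and the zero
   function will do *)
have [es|nes] := pselect (eps_small c p Delta L sigma eps gamma lambda); last first.
  exists (fun=> 0), (fun _ _ => 0), 0; split => //.
  - by rewrite lexx ler01.
  - split.
      rewrite /gap_le sub0e leeNl; apply/ereal_infP => _ [x _ <-] /=.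
      by rewrite lee_fin oppr_le0 ltW.
    have d0 (x : R) : derive1 (fun=> 0 : R) x = 0 :> R by exact: derive1_cst.
    split=> [x|x z]; first exact: derivable_cst.
    by rewrite !d0 subrr normr0 mulr_ge0// ltW.
  - by apply: zero_oracle_for; lra.
set q := q_of p sigma eps; set a := lambda * q / eps.
have q0 : 0 < q by exact: q_of_gt0.
have a0 : 0 <= a by rewrite divr_ge0 ?mulr_ge0// ltW.
have [[c0 ceq] _] := cu.
have [eDL _ es3] := es.
have X16 : 16 <= ratio gamma a L eps.
  exact: (@ratio_ge16 _ c).
pose y := descent_path gamma a x1.
have y_lt n : y n < y n.+1 by exact: descent_path_lt.
set H := horizon gamma a L eps Delta; set N := Num.truncn H.
have H0 : 0 < H by exact: horizon_gt0.
pose f := hard_fun y N L eps.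
exists f, (sparse_oracle q eps (derive1 f)), q; split.
- by rewrite (ltW q0)/= q_of_le1.
- by split; [exact: hard_fun_gap | exact: hard_fun_smooth].
- exact: sparse_oracle_for.
move=> _ d Om P r fr T T0 Eavg.
have Tn0 : 0 < T%:R :> R by rewrite ltr0n.
have [kq qk] := kP sigma eps sigma0 eps0.
have HT : H <= 2 * q * T%:R.
  apply: (@markov_hits R d Om P r q eps H T _ eps0 H0 _ _ _ Eavg).
  - move=> n; have [/(_ [set true]) fn _] := fr n.
    have q01 : 0 <= q <= 1 by rewrite (ltW q0)/= q_of_le1.
    have qE := bernoulli_probE q01 [set true].
    apply: (etrans fn); apply: (etrans qE).
    rewrite !diracE mem_set// memNset// mule1 mule0 adde0//.
  - by move=> w; rewrite mulr_ge0 ?invr_ge0// sumr_ge0.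
  - move=> w; apply: (@avg_grad_lower_bound _ q eps _ _ _ gamma lambda x1 N) => //.
    by move=> k kN; exact: derive1_hard_fun_node.
rewrite ler_pdivrMl//.
exact: (@complexity_le R p Delta L sigma eps gamma lambda kappa).
Qed.
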